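(* Let $B_1=\{(x,y)\in\mathbb{R}^2 : x^2+y^2<1\}$, let $r^2=x^2+y^2$, and let $h$ be the symmetric $2$-tensor on $B_1$ $$h=(x\,dx+y\,dy)^2+2r^2(x\,dx+y\,dy)(x\,dy-y\,dx)+r^2(x\,dy-y\,dx)^2 ,$$ which is positive definite on $B_1\setminus\{0\}$. Let $f:\mathbb{R}^2\to\mathbb{R}$, $f(p)=\frac{|p|^2}{1+|p|^2}$, and let $I:\mathbb{R}^2\setminus\{0\}\to\mathbb{R}^2\setminus\{0\}$, $I(p)=\frac{p}{|p|^2}$. Consider on $\mathbb{R}^2\setminus\overline{B_1}=I^{-1}(B_1\setminus\{0\})$ the smooth semi-algebraic Riemannian metric $I^*h$ and the function $I^*(-f)=-f\circ I$. Then any gradient curve $\gamma$ of the function $I^*(-f)$ for the metric $I^*h$ leaves any compact subset of $\mathbb{R}^2$ and accumulates on the whole boundary circle at infinity; in other words, for any unit vector $u\in\mathbb{S}^1$ there exists a sequence $(p_k)_k$ of points of $\gamma$ such that $|p_k|\to\infty$ and $\frac{p_k}{|p_k|}\to u$ as $k\to\infty$.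
   Context: $|\cdot|$ is the Euclidean norm on $\mathbb{R}^2$, $\mathbb{S}^1$ is the unit circle, and $\overline{B_1}$ is the closed unit disk. Products of $1$-forms in the formula for $h$ are symmetric products, so that the quadratic form is $h_{(x,y)}(u,v)=(xu+yv)^2+2r^2(xu+yv)(xv-yu)+r^2(xv-yu)^2$ for a tangent vector $(u,v)$. $I^*h$ denotes the pull-back tensor $(I^*h)_p(v,w)=h_{I(p)}(d_pI\,v,d_pI\,w)$, and $I^*g=g\circ I$ for a function $g$. For a function $g$ and a Riemannian metric $m$, the gradient $\nabla_mg$ is the vector field defined by $dg(v)=m(\nabla_mg,v)$ for all tangent vectors $v$. A gradient curve $\gamma$ of $g$ for $m$ is a maximal forward solution $\gamma:[0,T)\to\mathbb{R}^2\setminus\overline{B_1}$, $T\in(0,+\infty]$, of $\dot\gamma=\nabla_mg(\gamma)$ with $\gamma(0)\in\mathbb{R}^2\setminus\overline{B_1}$ arbitrary. It leaves any compact subset of $\mathbb{R}^2$ if for every compact $K\subset\mathbb{R}^2$ there is $t_0\in[0,T)$ such that $\gamma(t)\notin K$ for all $t\in(t_0,T)$. *)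

(* Defs.v *)
From HB Require Import structures.
From mathcomp Require Import all_boot all_order all_algebra.
From mathcomp Require Import all_classical all_reals all_analysis.
From mathcomp Require mpoly.
Set Implicit Arguments.
Unset Strict Implicit.
Unset Printing Implicit Defensive.
Import Order.TTheory GRing.Theory Num.Theory.
Import numFieldNormedType.Exports.
Local Open Scope classical_set_scope.
Local Open Scope ring_scope.

Notation plane R := 'rV[R]_2.

Definition xcoord (R : realType) (p : plane R) : R := p ord0 ord0.
Definition ycoord (R : realType) (p : plane R) : R := p ord0 ord_max.

(* The library norm on ['rV[R]_2] is the sup norm; only the topology it
   induces is used below, and the Euclidean norm is [enorm]. *)
Definition enorm (R : realType) (p : plane R) : R :=
  Num.sqrt (xcoord p ^+ 2 + ycoord p ^+ 2).

Definition open_disk (R : realType) : set (plane R) := [set p | enorm p < 1].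
Definition closed_disk (R : realType) : set (plane R) := [set p | enorm p <= 1].
Definition circle (R : realType) : set (plane R) := [set u | enorm u = 1].

(* Tangent spaces are identified with the plane; a 1-form or a 2-tensor is only
   meaningful at the points of the domain under consideration. *)
Definition one_form (R : realType) := plane R -> plane R -> R.
Definition two_tensor (R : realType) := plane R -> plane R -> plane R -> R.

Definition dx (R : realType) : one_form R := fun _ v => xcoord v.
Definition dy (R : realType) : one_form R := fun _ v => ycoord v.

Definition symprod (R : realType) (a b : one_form R) : two_tensor R :=
  fun p v w => (a p v * b p w + a p w * b p v) / 2.

(* x dx + y dy and x dy - y dx *)
Definition radial_form (R : realType) : one_form R :=
  fun p v => xcoord p * dx p v + ycoord p * dy p v.
Definition angular_form (R : realType) : one_form R :=
  fun p v => xcoord p * dy p v - ycoord p * dx p v.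

Definition h (R : realType) : two_tensor R := fun p v w =>
  symprod (@radial_form R) (@radial_form R) p v w
  + 2 * enorm p ^+ 2 * symprod (@radial_form R) (@angular_form R) p v w
  + enorm p ^+ 2 * symprod (@angular_form R) (@angular_form R) p v w.

Definition f (R : realType) (p : plane R) : R :=
  enorm p ^+ 2 / (1 + enorm p ^+ 2).

(* Junk value [inversion 0 = 0]. *)
Definition inversion (R : realType) (p : plane R) : plane R :=
  (enorm p ^+ 2)^-1 *: p.

Definition pullback_tensor (R : realType) (F : plane R -> plane R)
    (m : two_tensor R) : two_tensor R :=
  fun p v w => m (F p) ('d F p v) ('d F p w).

Definition pullback_fun (R : realType) (F : plane R -> plane R)
    (g : plane R -> R) : plane R -> R := g \o F.

Definition positive_definite_on (R : realType) (U : set (plane R))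
    (m : two_tensor R) : Prop :=
  forall p v, U p -> v != 0 -> 0 < m p v v.

Definition bilinear_on (R : realType) (U : set (plane R))
    (m : two_tensor R) : Prop :=
  forall p, U p -> forall (a : R) (v v' w : plane R),
    m p (a *: v + v') w = a * m p v w + m p v' w /\
    m p w (a *: v + v') = a * m p w v + m p w v'.

Definition symmetric_on (R : realType) (U : set (plane R))
    (m : two_tensor R) : Prop :=
  forall p v w, U p -> m p v w = m p w v.

Definition basis_vector (R : realType) (i : 'I_2) : plane R := delta_mx ord0 i.

Fixpoint iter_partial (R : realType) (s : seq 'I_2) (g : plane R -> R)
    : plane R -> R :=
  if s is i :: s' then fun p => 'D_(basis_vector R i) (iter_partial s' g) p
  else g.

Definition smooth_on (R : realType) (U : set (plane R)) (g : plane R -> R) :=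
  forall (s : seq 'I_2) p, U p ->
    {for p, continuous (iter_partial s g)} /\
    forall i, derivable (iter_partial s g) p (basis_vector R i).

Inductive semialgebraic (R : realType) (n : nat) : set 'rV[R]_n -> Prop :=
| semialgebraic_pos (P : mpoly.mpoly n R) :
    semialgebraic [set x : 'rV[R]_n | 0 < mpoly.meval (fun i => x ord0 i) P]
| semialgebraic_setC A : semialgebraic A -> semialgebraic (~` A)
| semialgebraic_setU A B :
    semialgebraic A -> semialgebraic B -> semialgebraic (A `|` B).

Definition semialgebraic_fun_on (R : realType) (U : set (plane R))
    (g : plane R -> R) : Prop :=
  semialgebraic [set row_mx p (const_mx (g p) : 'rV[R]_1) | p in U].

Definition coefficient (R : realType) (m : two_tensor R) (i j : 'I_2)
    : plane R -> R :=
  fun p => m p (basis_vector R i) (basis_vector R j).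

Record smooth_semialgebraic_metric_on (R : realType) (U : set (plane R))
    (m : two_tensor R) : Prop := {
  metric_bilinear : bilinear_on U m;
  metric_symmetric : symmetric_on U m;
  metric_positive_definite : positive_definite_on U m;
  metric_smooth : forall i j, smooth_on U (coefficient m i j);
  metric_semialgebraic : forall i j, semialgebraic_fun_on U (coefficient m i j)
}.

(* [w] is the gradient of [g] at [p]: it is unique when [m p] is positive
   definite. *)
Definition is_gradient (R : realType) (m : two_tensor R) (g : plane R -> R)
    (p w : plane R) : Prop :=
  forall v : plane R, 'd g p v = m p w v.

Definition time_domain (R : realType) (T : \bar R) : set R :=
  [set t | 0 <= t /\ (t%:E < T)%E].

(* Derivative relative to the domain, hence one-sided at its endpoint 0. *)
Definition has_derivative_within (R : realType) (D : set R)
    (c : R -> plane R) (t : R) (w : plane R) : Prop :=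
  (s - t)^-1 *: (c s - c t) @[s --> within D t^'] --> w.

(* The values of [c] outside [time_domain T] are irrelevant. *)
Record gradient_solution (R : realType) (U : set (plane R)) (m : two_tensor R)
    (g : plane R -> R) (T : \bar R) (c : R -> plane R) : Prop := {
  solution_time : (0 < T)%E;
  solution_in : forall t, time_domain T t -> U (c t);
  solution_ode : forall t, time_domain T t ->
    exists2 w, is_gradient m g (c t) w
             & has_derivative_within (time_domain T) c t w
}.

Definition gradient_curve (R : realType) (U : set (plane R)) (m : two_tensor R)
    (g : plane R -> R) (T : \bar R) (c : R -> plane R) : Prop :=
  gradient_solution U m g T c /\
  forall (T' : \bar R) (c' : R -> plane R),
    gradient_solution U m g T' c' -> (T <= T')%E ->
    (forall t, time_domain T t -> c' t = c t) -> T' = T.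

Definition leaves_compacts (R : realType) (T : \bar R) (c : R -> plane R) :=
  forall K : set (plane R), compact K ->
    exists2 t0, time_domain T t0 &
      forall t, t0 < t -> (t%:E < T)%E -> ~ K (c t).

Definition clusters_on_circle_at_infinity (R : realType) (T : \bar R)
    (c : R -> plane R) : Prop :=
  forall u : plane R, circle u ->
    exists p : nat -> plane R,
      [/\ forall k, exists2 t, time_domain T t & p k = c t,
          enorm (p k) @[k --> \oo] --> +oo
        & (enorm (p k))^-1 *: p k @[k --> \oo] --> u].

(* Main.v *)
(** Write [N = |p|^2] and [J] for the rotation by a right angle. In the basis
    [p, J p] the gradient at [p] of the inverted potential for the inverted
    metric is [speed N * (p + J p)]: the curve turns exactly as fast as
    [k = ln |p|] grows, so it runs along a logarithmic spiral
    [exp(k) Rot(k) q]. Moreover [s = exp(-2k) = 1/N] satisfies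
    [(1 - s)(1 + s)^2 s' = -4], hence [clock s = clock s0 - 4 t] where [clock] is
    the primitive of [(1 - s)(1 + s)^2] vanishing at [0]. Inverting [clock] gives
    a spiral solution on [[0, clock s0 / 4)], which extends every solution with
    the same initial point; a maximal solution is thus the whole spiral, along
    which [k] takes all values in [[k 0, +oo)]. *)

Require Import Defs.
From mathcomp Require Import all_boot all_order all_algebra.
From mathcomp Require Import all_classical all_reals all_analysis.
From mathcomp Require mpoly.
From mathcomp Require Import ring lra.
Import Order.TTheory GRing.Theory Num.Theory.
Import numFieldNormedType.Exports.
(* Full import of [mpoly] would clash with notations of mathcomp-analysis. *)
Import (canonicals) mpoly.
Local Open Scope classical_set_scope.
Local Open Scope ring_scope.

Local Notation exterior R := (~` @closed_disk R).
Local Notation inverted_metric R := (pullback_tensor (@inversion R) (@h R)).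
Local Notation inverted_potential R :=
  (pullback_fun (@inversion R) (fun p => - f p)).

(** * The inverted metric *)

Definition pt {R : realType} (a b : R) : plane R :=
  \row_j (if j == ord0 then a else b).

(** The squared Euclidean norm, free of the square root, so that it is a polynomial that can be
    differentiated directly. *)
Definition sqn {R : realType} (p : plane R) : R := xcoord p ^+ 2 + ycoord p ^+ 2.

Lemma xcoord_pt (R : realType) (a b : R) : xcoord (pt a b) = a.
Proof. by rewrite /xcoord mxE. Qed.

Lemma ycoord_pt (R : realType) (a b : R) : ycoord (pt a b) = b.
Proof. by rewrite /ycoord mxE. Qed.

Lemma ord2E (j : 'I_2) : j = ord0 \/ j = ord_max.
Proof. by case: j => [[|[|//]] ?]; [left|right]; apply/val_inj. Qed.

Lemma plane_eqP (R : realType) (p q : plane R) :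
  xcoord p = xcoord q -> ycoord p = ycoord q -> p = q.
Proof. by move=> xpq ypq; apply/rowP => j; case: (ord2E j) => ->. Qed.

Lemma pt_coord (R : realType) (p : plane R) : pt (xcoord p) (ycoord p) = p.
Proof. by apply: plane_eqP; rewrite ?xcoord_pt ?ycoord_pt. Qed.

Lemma xcoordD (R : realType) (p q : plane R) : xcoord (p + q) = xcoord p + xcoord q.
Proof. by rewrite /xcoord mxE. Qed.
Lemma ycoordD (R : realType) (p q : plane R) : ycoord (p + q) = ycoord p + ycoord q.
Proof. by rewrite /ycoord mxE. Qed.
Lemma xcoordN (R : realType) (p : plane R) : xcoord (- p) = - xcoord p.
Proof. by rewrite /xcoord mxE. Qed.
Lemma ycoordN (R : realType) (p : plane R) : ycoord (- p) = - ycoord p.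
Proof. by rewrite /ycoord mxE. Qed.
Lemma xcoordZ (R : realType) a (p : plane R) : xcoord (a *: p) = a * xcoord p.
Proof. by rewrite /xcoord mxE. Qed.
Lemma ycoordZ (R : realType) a (p : plane R) : ycoord (a *: p) = a * ycoord p.
Proof. by rewrite /ycoord mxE. Qed.
Definition coordE := (xcoordD, ycoordD, xcoordN, ycoordN, xcoordZ, ycoordZ,
  xcoord_pt, ycoord_pt).

Lemma sqn_ge0 (R : realType) (p : plane R) : 0 <= sqn p.
Proof. by rewrite addr_ge0 ?sqr_ge0. Qed.

Lemma enorm_ge0 (R : realType) (p : plane R) : 0 <= enorm p.
Proof. exact: sqrtr_ge0. Qed.

Lemma enorm_sqr (R : realType) (p : plane R) : enorm p ^+ 2 = sqn p.
Proof. exact/sqr_sqrtr/sqn_ge0. Qed.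

Lemma sqn_eq0 (R : realType) (p : plane R) : (sqn p == 0) = (p == 0).
Proof.
rewrite paddr_eq0 ?sqr_ge0// !sqrf_eq0; apply/andP/eqP => [[/eqP x0 /eqP y0]|->].
  by apply: plane_eqP; rewrite ?x0 ?y0 /xcoord /ycoord !mxE.
by rewrite /xcoord /ycoord !mxE eqxx.
Qed.

Lemma sqn_gt0 (R : realType) (p : plane R) : (0 < sqn p) = (p != 0).
Proof. by rewrite lt0r sqn_ge0 andbT sqn_eq0. Qed.

Lemma enorm_lt1 (R : realType) (p : plane R) : (enorm p < 1) = (sqn p < 1).
Proof.
by rewrite -enorm_sqr -[in RHS](expr1n _ 2) ltr_pXn2r// nnegrE ?enorm_ge0.
Qed.

Lemma exteriorE (R : realType) (p : plane R) : (exterior R) p <-> 1 < sqn p.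
Proof.
rewrite /closed_disk /=.
have -> : (enorm p <= 1) = (sqn p <= 1).
  by rewrite -enorm_sqr -[in RHS](expr1n _ 2) ler_pXn2r// nnegrE ?enorm_ge0.
by split=> [/negP|?]; [|apply/negP]; rewrite -ltNge.
Qed.

Lemma sqn_inversion (R : realType) (p : plane R) : sqn (inversion p) = (sqn p)^-1.
Proof.
rewrite /inversion enorm_sqr /sqn !coordE !exprMn -mulrDr -/(sqn p).
have [->|p0] := eqVneq (sqn p) 0; first by rewrite invr0 mulr0.
by rewrite expr2 -mulrA mulVf ?mulr1.
Qed.

Lemma exterior_inversion (R : realType) :
  exterior R = [set p | p != 0 /\ (@open_disk R `\ 0) (inversion p)].
Proof.
apply/seteqP; split=> p.
  move=> /exteriorE p1; have p0 : 0 < sqn p by apply: lt_trans p1.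
  split; first by rewrite -sqn_gt0.
  split; first by rewrite /open_disk/= enorm_lt1 sqn_inversion invf_lt1.
  by apply/eqP; rewrite -sqn_eq0 sqn_inversion invr_eq0 gt_eqF.
move=> [p0 [+ _]]; rewrite /open_disk/= enorm_lt1 sqn_inversion.
by move=> p1; apply/exteriorE; rewrite -invf_lt1// sqn_gt0.
Qed.

Lemma hE (R : realType) (p v w : plane R) :
  h p v w = radial_form p v * radial_form p w
    + sqn p * (radial_form p v * angular_form p w
               + radial_form p w * angular_form p v)
    + sqn p * (angular_form p v * angular_form p w).
Proof. by rewrite /h /symprod enorm_sqr; field. Qed.

(* Lagrange's identity: the two forms are independent away from the origin. *)
Lemma radial_angular (R : realType) (p v : plane R) :
  radial_form p v ^+ 2 + angular_form p v ^+ 2 = sqn p * sqn v.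
Proof. by rewrite /radial_form /angular_form /sqn /dx /dy; ring. Qed.

Lemma h_positive_definite (R : realType) :
  positive_definite_on (@open_disk R `\ 0) (@h R).
Proof.
move=> p v [+ /eqP p0] v0; rewrite /open_disk/= enorm_lt1 => p1.
rewrite -sqn_gt0 in p0; rewrite -sqn_gt0 in v0.
have := mulr_gt0 p0 v0; rewrite -radial_angular hE.
set a := radial_form p v; set b := angular_form p v; set N := sqn p in p0 p1 *.
move=> ab0.
(* Completing the square in [a]. Since [0 < N < 1], only [b = 0] could spoil positivity, and then
   [ab0] gives [0 < a ^+ 2]. *)
have -> : a * a + N * (a * b + a * b) + N * (b * b) =
  (a + N * b) ^+ 2 + N * (1 - N) * b ^+ 2 by ring.
have N1 : 0 < N * (1 - N) by rewrite mulr_gt0// subr_gt0.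
have [b0|b0] := eqVneq b 0.
  by move: ab0; rewrite b0 !(mulr0, addr0, expr0n)/= ?addr0.
by rewrite ltr_wpDl ?sqr_ge0// mulr_gt0// lt0r sqr_ge0 sqrf_eq0 b0.
Qed.

(** * Differentials of the inversion and of the inverted potential *)

Lemma is_derive_recip (R : realType) (V : normedModType R) (g : V -> R)
    (p v : V) (dg : R) :
  g p != 0 -> is_derive p v g dg ->
  is_derive p v (fun q => (g q)^-1) (- (g p) ^- 2 * dg).
Proof.
move=> gp0 [gpv <-]; apply: DeriveDef; first exact: derivableV.
by rewrite deriveV.
Qed.

Lemma differentiable_xcoord (R : realType) (p : plane R) : differentiable (@xcoord R) p.
Proof. exact: differentiable_coord. Qed.

Lemma differentiable_ycoord (R : realType) (p : plane R) : differentiable (@ycoord R) p.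
Proof. exact: differentiable_coord. Qed.

Lemma derive_coord (R : realType) (p v : plane R) j :
  is_derive p v (fun q : plane R => q ord0 j) (v ord0 j).
Proof.
apply: DeriveDef; first exact/diff_derivable/differentiable_coord.
have := @derive_mx R (plane R) 1 2 id p v (@derivable_id _ _ p v).
by rewrite derive_id => /rowP/(_ j) ->; rewrite mxE.
Qed.

Lemma derive_sqn (R : realType) (p v : plane R) :
  is_derive p v (@sqn R) (2 * radial_form p v).
Proof.
have Dx := @derive_coord R p v ord0; have Dy := @derive_coord R p v ord_max.
have := is_deriveD (is_deriveM Dx Dx) (is_deriveM Dy Dy).
move=> H; rewrite (_ : @sqn R =
    (fun q : plane R => q ord0 ord0) * (fun q : plane R => q ord0 ord0) +
    (fun q : plane R => q ord0 ord_max) * (fun q : plane R => q ord0 ord_max)).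
  apply: is_derive_eq.
  rewrite /radial_form /dx /dy /xcoord /ycoord /GRing.scale/=; ring.
by apply/funext => q; rewrite /sqn !expr2.
Qed.

Lemma differentiable_sqn (R : realType) (p : plane R) : differentiable (@sqn R) p.
Proof.
rewrite (_ : @sqn R = @xcoord R ^+ 2 + @ycoord R ^+ 2); last first.
  by apply/funext => q; rewrite /sqn !expr2.
apply: differentiableD; apply: differentiableX.
  exact: differentiable_xcoord.
exact: differentiable_ycoord.
Qed.

(** Scalar quotients times constant vectors: differentiability of the inversion reduces to that of
    real-valued functions. *)
Lemma inversion_pt (R : realType) (p : plane R) :
  inversion p = (xcoord p / sqn p) *: pt 1 0 + (ycoord p / sqn p) *: pt 0 1.
Proof.
rewrite /inversion enorm_sqr; apply: plane_eqP; rewrite !coordE; ring.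
Qed.

Lemma differentiable_inversion (R : realType) (p : plane R) :
  p != 0 -> differentiable (@inversion R) p.
Proof.
rewrite -sqn_eq0 => p0.
rewrite (_ : @inversion R =
  (fun q => (xcoord q / sqn q) *: pt 1 0) + (fun q => (ycoord q / sqn q) *: pt 0 1)); last first.
  by apply/funext => q; rewrite inversion_pt.
apply: differentiableD; apply: differentiableZl; apply: differentiableM.
- exact: differentiable_xcoord.
- exact: differentiableV (@differentiable_sqn R p) p0.
- exact: differentiable_ycoord.
- exact: differentiableV (@differentiable_sqn R p) p0.
Qed.

(** Product rule on [(sqn q)^-1 * q_j] in each coordinate. Up to the factor [(sqn p)^-1] this is the
    reflection in the line orthogonal to [p]. *)
Lemma diff_inversion (R : realType) (p v : plane R) : p != 0 ->
  'd (@inversion R) p v =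
    (sqn p)^-1 *: v - (2 * radial_form p v / sqn p ^+ 2) *: p.
Proof.
move=> p0; rewrite -deriveE; last exact: differentiable_inversion.
rewrite derive_mx; last exact/diff_derivable/differentiable_inversion.
apply/rowP => j; rewrite !mxE.
have p0' := p0; rewrite -sqn_eq0 in p0'.
have := is_deriveM (is_derive_recip _ _ _ _ v _ p0' (derive_sqn R p v))
  (@derive_coord R p v j).
set F := (X in is_derive _ _ X _ -> _) => H.
rewrite (_ : (fun t : plane R => inversion t ord0 j) = F); last first.
  by apply/funext => q; rewrite /inversion mxE enorm_sqr.
rewrite derive_val /GRing.scale/=; field.
by rewrite p0'.
Qed.

Lemma radial_form_lin (R : realType) (p v w : plane R) a :
  radial_form p (a *: v + w) = a * radial_form p v + radial_form p w.
Proof. by rewrite /radial_form /dx /dy !coordE; ring. Qed.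

Lemma angular_form_lin (R : realType) (p v w : plane R) a :
  angular_form p (a *: v + w) = a * angular_form p v + angular_form p w.
Proof. by rewrite /angular_form /dx /dy !coordE; ring. Qed.

(** Under the inversion both forms are divided by [sqn p ^+ 2], and the radial one also changes sign
    while the angular one does not. Hence the minus sign on the mixed term; the fifth powers come
    from the factor [sqn] in [h], which becomes [(sqn p)^-1]. *)
Lemma metricE (R : realType) (p v w : plane R) : p != 0 ->
  inverted_metric R p v w =
    radial_form p v * radial_form p w * (sqn p)^-1 ^+ 4
    - (radial_form p v * angular_form p w
       + radial_form p w * angular_form p v) * (sqn p)^-1 ^+ 5
    + angular_form p v * angular_form p w * (sqn p)^-1 ^+ 5.
Proof.
move=> p0; rewrite /pullback_tensor hE sqn_inversion !diff_inversion//.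
rewrite -sqn_eq0 in p0.
have rE u :
  radial_form (inversion p) ((sqn p)^-1 *: u - (2 * radial_form p u / sqn p ^+ 2) *: p) =
  - radial_form p u / sqn p ^+ 2.
  rewrite {1}/radial_form /inversion enorm_sqr /dx /dy !coordE.
  have -> : radial_form p u = xcoord p * xcoord u + ycoord p * ycoord u by [].
  move: p0; rewrite /sqn => p0; field; exact: p0.
have aE u :
  angular_form (inversion p) ((sqn p)^-1 *: u - (2 * radial_form p u / sqn p ^+ 2) *: p) =
  angular_form p u / sqn p ^+ 2.
  rewrite /angular_form /inversion enorm_sqr /dx /dy !coordE.
  field; exact: p0.
rewrite !rE !aE; field; exact: p0.
Qed.

Lemma potentialE (R : realType) (p : plane R) : p != 0 ->
  inverted_potential R p = - (1 + sqn p)^-1.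
Proof.
rewrite -sqn_gt0 => p0.
rewrite /pullback_fun /f/= enorm_sqr sqn_inversion; field.
by rewrite !gt_eqF// addr_gt0.
Qed.

Lemma sqn_gt_near (R : realType) (p : plane R) (a : R) :
  a < sqn p -> \forall q \near p, a < sqn q.
Proof.
exact: (@cvgr_gt R _ (nbhs p) _ (@sqn R) _
  (differentiable_continuous (differentiable_sqn _ p)) a).
Qed.

Lemma neq0_near (R : realType) (p : plane R) : p != 0 -> \forall q \near p, q != 0.
Proof.
rewrite -sqn_gt0 => /sqn_gt_near; apply: filterS => q.
by rewrite sqn_gt0.
Qed.

Lemma diff_potential (R : realType) (p v : plane R) : p != 0 ->
  'd (inverted_potential R) p v =
    2 * radial_form p v * (1 + sqn p)^-1 ^+ 2.
Proof.
move=> p0; rewrite -deriveE; last first.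
  apply: differentiable_comp; first exact: differentiable_inversion.
  rewrite (_ : (fun p => - f p) = - (fun q => sqn q / (1 + sqn q))); last first.
    by apply/funext => q; rewrite /f enorm_sqr.
  apply/differentiableN/differentiableM; first exact: differentiable_sqn.
  apply: differentiableV; last by rewrite gt_eqF// ltr_wpDr// sqn_ge0.
  by apply: differentiableD; [exact: differentiable_cst|exact: differentiable_sqn].
have n0 : 1 + sqn p != 0 by rewrite gt_eqF// ltr_wpDr// sqn_ge0.
have D0 : is_derive p v (cst 1 + @sqn R) (0 + 2 * radial_form p v).
  by apply: is_deriveD; exact: derive_sqn.
have D1 := is_deriveN (is_derive_recip R _ (cst 1 + @sqn R) _ _ _ n0 D0).
(* The closed form of the potential fails at the origin, so the derivative is transferred through
   equality near [p]. *)
rewrite (near_eq_derive (g := - (fun q => ((cst 1 + @sqn R) q)^-1))); last first.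
  near=> q; rewrite potentialE//; near: q; exact: neq0_near.
rewrite (@derive_val _ _ _ _ _ _ _ D1).
have -> : (cst 1 + @sqn R) p = 1 + sqn p by [].
by field.
Unshelve. all: by end_near. Qed.

(** * Smoothness and semi-algebraicity *)

(** The algebra generated by the coordinates and [1 / sqn]. It contains the coefficients of the
    inverted metric, and powers of [sqn] are its only denominators. *)
Inductive rational {R : realType} : (plane R -> R) -> Prop :=
| rational_cst c : rational (fun=> c)
| rational_coord j : rational (fun p => p ord0 j)
| rational_invsqn : rational (fun p => (sqn p)^-1)
| rational_add g1 g2 : rational g1 -> rational g2 -> rational (fun p => g1 p + g2 p)
| rational_mul g1 g2 : rational g1 -> rational g2 -> rational (fun p => g1 p * g2 p).

Lemma rational_opp (R : realType) (g : plane R -> R) :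
  rational g -> rational (fun p => - g p).
Proof.
move=> rg; rewrite (_ : (fun p => - g p) = (fun p => -1 * g p)).
  by apply: rational_mul => //; exact: rational_cst.
by apply/funext => p; rewrite mulN1r.
Qed.

Lemma rational_exp (R : realType) (g : plane R -> R) n :
  rational g -> rational (fun p => g p ^+ n).
Proof.
move=> rg; elim: n => [|n IH].
  by rewrite (_ : (fun p => g p ^+ 0) = (fun=> 1)); [exact: rational_cst|].
rewrite (_ : (fun p => g p ^+ n.+1) = (fun p => g p * g p ^+ n)).
  exact: rational_mul.
by apply/funext => p; rewrite exprS.
Qed.

Lemma rational_differentiable (R : realType) (g : plane R -> R) (p : plane R) :
  rational g -> p != 0 -> differentiable g p.
Proof.
move=> rg p0; elim: rg => [c|j||g1 g2 _ d1 _ d2|g1 g2 _ d1 _ d2].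
- exact: differentiable_cst.
- exact: differentiable_coord.
- by apply: differentiableV; [exact: differentiable_sqn|rewrite sqn_eq0].
- exact: differentiableD.
- exact: differentiableM.
Qed.

(** Closure under differentiation: the one generator that is not polynomial has derivative
    [- 2 * radial_form p v / sqn p ^+ 2], again in the algebra. *)
Lemma rational_derive (R : realType) (g : plane R -> R) (v : plane R) :
  rational g -> exists2 g', rational g' & forall p, p != 0 -> 'D_v g p = g' p.
Proof.
move=> rg;
have dg h p : rational h -> p != 0 -> derivable h p v.
  by move=> rh p0; exact/diff_derivable/rational_differentiable.
elim: rg => [c|j||g1 g2 r1 [g1' r1' e1] r2 [g2' r2' e2]
                 |g1 g2 r1 [g1' r1' e1] r2 [g2' r2' e2]].
- exists (fun=> 0); first exact: rational_cst.
  by move=> p _; rewrite derive_cst.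
- exists (fun=> v ord0 j); first exact: rational_cst.
  by move=> p _; have D := derive_coord R p v j; rewrite derive_val.
- exists (fun p : plane R => - (2 * (p ord0 ord0 * v ord0 ord0 + p ord0 ord_max * v ord0 ord_max))
      * (sqn p)^-1 ^+ 2).
    apply: rational_mul; last exact/rational_exp/rational_invsqn.
    apply/rational_opp/rational_mul; first exact: rational_cst.
    by apply: rational_add; apply: rational_mul;
      (exact: rational_cst || exact: rational_coord).
  move=> p; rewrite -sqn_eq0 => p0.
  have D := is_derive_recip _ _ _ _ v _ p0 (derive_sqn R p v).
  by rewrite derive_val /radial_form /dx /dy /xcoord /ycoord; field.
- exists (fun p => g1' p + g2' p); first exact: rational_add.
  move=> p p0; rewrite -e1// -e2// -deriveD//; exact: dg.
- exists (fun p => g1 p * g2' p + g2 p * g1' p).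
    by apply: rational_add; exact: rational_mul.
  move=> p p0; rewrite -e1// -e2//.
  by rewrite (_ : (fun _ => _) = g1 * g2)// deriveM//; exact: dg.
Qed.

Lemma near_exterior (R : realType) (p : plane R) :
  (exterior R) p -> \forall q \near p, (exterior R) q.
Proof. by move/exteriorE/sqn_gt_near; apply: filterS => q /exteriorE. Qed.

Lemma exterior_neq0 (R : realType) (p : plane R) : (exterior R) p -> p != 0.
Proof. by move/exteriorE => p1; rewrite -sqn_gt0 (lt_trans _ p1). Qed.

(** By induction on the word of partial derivatives: the exterior is open, so agreement with a
    rational function there passes to the derivatives. *)
Lemma rational_smooth (R : realType) (g g0 : plane R -> R) :
  rational g0 -> (forall p, (exterior R) p -> g p = g0 p) ->
  smooth_on (exterior R) g.
Proof.
move=> rg0 gg0 s.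
have [g1 rg1 g1E] : exists2 g1, rational g1 &
    forall p, (exterior R) p -> iter_partial s g p = g1 p.
  elim: s => [|i s [g1 rg1 g1E]]; first by exists g0.
  have [g2 rg2 g2E] := rational_derive _ _ (basis_vector R i) rg1.
  exists g2 => // p Up; rewrite -g2E; last exact: exterior_neq0.
  by apply: near_eq_derive; apply: filterS (near_exterior _ _ Up) => q; exact: g1E.
move=> p Up.
have e : \forall q \near p, g1 q = iter_partial s g q.
  by apply: filterS (near_exterior _ _ Up) => q /g1E.
have dg1 := rational_differentiable _ _ _ rg1 (exterior_neq0 _ _ Up).
split; last first.
  by move=> i; apply: (near_eq_derivable (f := g1)); last exact: (@diff_derivable _ _ _ g1 p).
rewrite /prop_for /continuous_at g1E//.
exact: cvg_trans (near_eq_cvg e) (differentiable_continuous dg1).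
Qed.

(** * Polynomial functions and semi-algebraic graphs *)

Definition polynomial_fun {R : realType} {n} (G : 'rV[R]_n -> R) :=
  exists P : mpoly.mpoly n R, forall z, G z = mpoly.meval (fun i => z ord0 i) P.

Lemma polynomial_cst (R : realType) n c : polynomial_fun (fun _ : 'rV[R]_n => c).
Proof. by exists (mpoly.mpolyC n c) => z; rewrite mpoly.mevalC. Qed.

Lemma polynomial_coord (R : realType) n (j : 'I_n) :
  polynomial_fun (fun z : 'rV[R]_n => z ord0 j).
Proof. by exists (mpoly.mpolyX R (mpoly.mnm1 j)) => z; rewrite mpoly.mevalXU. Qed.

Lemma polynomial_add (R : realType) n (F G : 'rV[R]_n -> R) :
  polynomial_fun F -> polynomial_fun G -> polynomial_fun (fun z => F z + G z).
Proof.
by move=> [P PE] [Q QE]; exists (P + Q) => z; rewrite mpoly.mevalD PE QE.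
Qed.

Lemma polynomial_mul (R : realType) n (F G : 'rV[R]_n -> R) :
  polynomial_fun F -> polynomial_fun G -> polynomial_fun (fun z => F z * G z).
Proof.
by move=> [P PE] [Q QE]; exists (P * Q) => z; rewrite mpoly.mevalM PE QE.
Qed.

Lemma polynomial_opp (R : realType) n (F : 'rV[R]_n -> R) :
  polynomial_fun F -> polynomial_fun (fun z => - F z).
Proof. by move=> [P PE]; exists (- P) => z; rewrite mpoly.mevalN PE. Qed.

Lemma polynomial_exp (R : realType) n (F : 'rV[R]_n -> R) k :
  polynomial_fun F -> polynomial_fun (fun z => F z ^+ k).
Proof.
by move=> [P PE]; exists (P ^+ k) => z; rewrite rmorphXn/= PE.
Qed.

Lemma semialgebraic_gt0 (R : realType) n (F : 'rV[R]_n -> R) :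
  polynomial_fun F -> semialgebraic [set z | 0 < F z].
Proof.
move=> [P PE].
rewrite (_ : [set z | 0 < F z] = [set z | 0 < mpoly.meval (fun i => z ord0 i) P]).
  exact: semialgebraic_pos.
by apply/seteqP; split => z /=; rewrite PE.
Qed.

Lemma semialgebraic_setI (R : realType) n (A B : set 'rV[R]_n) :
  semialgebraic A -> semialgebraic B -> semialgebraic (A `&` B).
Proof.
by move=> sA sB; rewrite -[_ `&` _]setCK setCI;
  apply/semialgebraic_setC/semialgebraic_setU;
  exact: semialgebraic_setC.
Qed.

Lemma semialgebraic_eq0 (R : realType) n (F : 'rV[R]_n -> R) :
  polynomial_fun F -> semialgebraic [set z | F z = 0].
Proof.
move=> pF.
(* Only strict inequalities are generators; an equation says that neither [F] nor [- F] is
   positive. *)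
rewrite (_ : [set z | F z = 0] = ~` ([set z | 0 < F z] `|` [set z | 0 < - F z])).
  apply/semialgebraic_setC/semialgebraic_setU; apply: semialgebraic_gt0 => //.
  exact: polynomial_opp.
apply/seteqP; split => z /=; first by move=> ->; rewrite oppr0 ltxx; case.
move=> H; apply/eqP; rewrite eq_le !leNgt -[F z < 0]oppr_gt0.
by apply/andP; split; apply/negP => ?; apply: H; [left|right].
Qed.

Lemma polynomial_coord_l (R : realType) j :
  polynomial_fun (fun z : 'rV[R]_(2 + 1) => lsubmx z ord0 j).
Proof.
have [P PE] := polynomial_coord R _ (lshift 1 j).
by exists P => z; rewrite -PE mxE.
Qed.

Lemma polynomial_sqn_l (R : realType) :
  polynomial_fun (fun z : 'rV[R]_(2 + 1) => sqn (lsubmx z)).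
Proof.
by apply: polynomial_add; apply: polynomial_exp; exact: polynomial_coord_l.
Qed.

(** A power of [sqn] clears all denominators. Everything is stated on the space of the graph, where
    [lsubmx z] is the point and the third coordinate is the value. *)
Lemma rational_clear_denominator (R : realType) (g : plane R -> R) : rational g ->
  exists k (G : 'rV[R]_(2 + 1) -> R), polynomial_fun G /\
    forall z, lsubmx z != 0 -> g (lsubmx z) * sqn (lsubmx z) ^+ k = G z.
Proof.
elim=> [c|j||g1 g2 _ [k1 [G1 [p1 e1]]] _ [k2 [G2 [p2 e2]]]
            |g1 g2 _ [k1 [G1 [p1 e1]]] _ [k2 [G2 [p2 e2]]]].
- exists 0%N, (fun=> c); split; first exact: polynomial_cst.
  by move=> z _; rewrite expr0 mulr1.
- exists 0%N, (fun z => lsubmx z ord0 j); split; first exact: polynomial_coord_l.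
  by move=> z _; rewrite expr0 mulr1.
- exists 1%N, (fun=> 1); split; first exact: polynomial_cst.
  by move=> z z0; rewrite expr1 mulVf// sqn_eq0.
- exists (k1 + k2)%N, (fun z => G1 z * sqn (lsubmx z) ^+ k2 + G2 z * sqn (lsubmx z) ^+ k1).
  split; last by move=> z z0; rewrite -e1// -e2// exprD; ring.
  by apply: polynomial_add; apply: polynomial_mul => //;
    apply: polynomial_exp; exact: polynomial_sqn_l.
- exists (k1 + k2)%N, (fun z => G1 z * G2 z); split; first exact: polynomial_mul.
  by move=> z z0; rewrite -e1// -e2// exprD; ring.
Qed.

Lemma rational_semialgebraic (R : realType) (g g0 : plane R -> R) :
  rational g0 -> (forall p, (exterior R) p -> g p = g0 p) ->
  semialgebraic_fun_on (exterior R) g.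
Proof.
move=> rg0 gg0; have [k [G [pG GE]]] := rational_clear_denominator _ _ rg0.
rewrite /semialgebraic_fun_on.
set A := (X in semialgebraic X).
(* Over the exterior [sqn] does not vanish, so the graph is cut out by the equation multiplied by
   [sqn ^+ k]. *)
rewrite (_ : A = [set z | 0 < sqn (lsubmx z) - 1] `&`
  [set z : 'rV[R]_(2 + 1) | z ord0 (rshift 2 ord0) * sqn (lsubmx z) ^+ k - G z = 0]).
  apply: semialgebraic_setI.
    apply/semialgebraic_gt0/polynomial_add; first exact: polynomial_sqn_l.
    exact: polynomial_cst.
  apply/semialgebraic_eq0/polynomial_add; last exact: polynomial_opp.
  apply: polynomial_mul; first exact: polynomial_coord.
  exact/polynomial_exp/polynomial_sqn_l.
apply/seteqP; split => z.
  move=> [p Up <-]; have p0 := exterior_neq0 _ _ Up.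
  split; rewrite /= row_mxKl.
    by rewrite subr_gt0; exact/exteriorE.
  by rewrite row_mxEr mxE gg0// -GE row_mxKl// subrr.
move=> [/=]; rewrite subr_gt0 => /exteriorE Uz; have z0 := exterior_neq0 _ _ Uz.
move=> /eqP; rewrite subr_eq0 -GE// => /eqP.
have N0 : sqn (lsubmx z) ^+ k != 0 by rewrite expf_neq0// sqn_eq0.
move=> /(mulIf N0) e; exists (lsubmx z) => //.
rewrite gg0// -e -[RHS]hsubmxK; congr row_mx.
by apply/rowP => j; rewrite !mxE (ord1 j).
Qed.

Lemma smooth_semialgebraic_inverted_metric (R : realType) :
  smooth_semialgebraic_metric_on (exterior R)
    (inverted_metric R).
Proof.
(* With the tangent vectors fixed, both forms are linear in the coordinates of [p], so [metricE]
   displays each coefficient as a rational function. *)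
have rE i j : exists2 g, rational g & forall p, (exterior R) p ->
    coefficient (inverted_metric R) i j p = g p.
  pose v := basis_vector R i; pose w := basis_vector R j.
  have rr u : rational (fun p => radial_form p u).
    by apply: rational_add; apply: rational_mul;
      (exact: rational_coord || exact: rational_cst).
  have ra u : rational (fun p => angular_form p u).
    apply: rational_add; last apply: rational_opp;
    by apply: rational_mul;
      (exact: rational_coord || exact: rational_cst).
  exists (fun p => radial_form p v * radial_form p w * (sqn p)^-1 ^+ 4
    - (radial_form p v * angular_form p w
       + radial_form p w * angular_form p v) * (sqn p)^-1 ^+ 5
    + angular_form p v * angular_form p w * (sqn p)^-1 ^+ 5); last first.
    by move=> p Up; rewrite /coefficient metricE//; exact: exterior_neq0.
  have rN n := rational_exp _ _ n (@rational_invsqn R).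
  apply: rational_add; last by apply: (rational_mul _ _ _ (rN _)); exact: rational_mul.
  apply: rational_add; first by apply: (rational_mul _ _ _ (rN _)); exact: rational_mul.
  by apply/rational_opp/(rational_mul _ _ _ (rN _)); apply: rational_add; exact: rational_mul.
split.
- move=> p /exterior_neq0 p0 a v v' w; rewrite !metricE//.
  by rewrite !radial_form_lin !angular_form_lin; split; ring.
- by move=> p v w /exterior_neq0 p0; rewrite !metricE//; ring.
- move=> p v Up v0; have p0 := exterior_neq0 _ _ Up.
  rewrite metricE//; move/exteriorE: Up => p1.
  rewrite -sqn_gt0 in p0; rewrite -sqn_gt0 in v0.
  have := mulr_gt0 p0 v0; rewrite -radial_angular.
  set a := radial_form p v; set b := angular_form p v.
  set N := sqn p in p0 p1 * => ab0.
  (* Here the square is completed in [b], leaving the factor [N - 1], positive outside the closed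
     disk. *)
  have -> : a * a * N^-1 ^+ 4 - (a * b + a * b) * N^-1 ^+ 5 + b * b * N^-1 ^+ 5
     = ((N - 1) * a ^+ 2 + (a - b) ^+ 2) * N^-1 ^+ 5.
    by field; rewrite gt_eqF.
  rewrite mulr_gt0 ?exprn_gt0 ?invr_gt0//.
  have N1 : 0 < N - 1 by rewrite subr_gt0.
  have [a0|a0] := eqVneq a 0.
    rewrite a0 sub0r sqrrN; move: ab0; rewrite a0.
    by rewrite expr0n/= mulr0 add0r.
  by rewrite ltr_wpDr ?sqr_ge0// mulr_gt0// lt0r sqr_ge0 sqrf_eq0 a0.
- by move=> i j; have [g rg gE] := rE i j; exact: rational_smooth rg gE.
- by move=> i j; have [g rg gE] := rE i j; exact: rational_semialgebraic rg gE.
Qed.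

(** * Derivatives relative to a time domain *)

(* [speed |p|^2] is the logarithmic radial speed of the gradient flow at [p]. *)
Definition speed {R : realType} (N : R) : R := 2 * N ^+ 4 / ((N - 1) * (1 + N) ^+ 2).

(** Testing the gradient equation against [p] and its rotation by a right angle, an orthogonal
    basis, determines the radial and angular parts of [w]: they turn out equal. *)
Lemma gradientE (R : realType) (p w : plane R) : (exterior R) p ->
  is_gradient (inverted_metric R)
    (inverted_potential R) p w <->
  w = speed (sqn p) *: pt (xcoord p - ycoord p) (xcoord p + ycoord p).
Proof.
move=> Up; have p0 := exterior_neq0 _ _ Up; move/exteriorE: Up => p1.
have N0 : sqn p != 0 by rewrite sqn_eq0.
have N1 : sqn p - 1 != 0 by rewrite subr_eq0 gt_eqF.
have NS : 1 + sqn p != 0 by rewrite gt_eqF// ltr_wpDr// sqn_ge0.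
split; last first.
  move=> -> v; rewrite diff_potential// metricE//.
  have -> : radial_form p (speed (sqn p) *: pt (xcoord p - ycoord p) (xcoord p + ycoord p))
     = speed (sqn p) * sqn p.
    by rewrite /radial_form /dx /dy !coordE /sqn; ring.
  have -> : angular_form p (speed (sqn p) *: pt (xcoord p - ycoord p) (xcoord p + ycoord p))
     = speed (sqn p) * sqn p.
    by rewrite /angular_form /dx /dy !coordE /sqn; ring.
  by rewrite /speed; field; rewrite ?N0 ?N1 ?NS.
move=> Hw.
have rp : radial_form p p = sqn p by rewrite /radial_form /dx /dy /sqn; ring.
have ap : angular_form p p = 0 by rewrite /angular_form /dx /dy; ring.
have rJ : radial_form p (pt (- ycoord p) (xcoord p)) = 0.
  by rewrite /radial_form /dx /dy !coordE; ring.
have aJ : angular_form p (pt (- ycoord p) (xcoord p)) = sqn p.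
  by rewrite /angular_form /dx /dy !coordE /sqn; ring.
have H1 := Hw p; have H2 := Hw (pt (- ycoord p) (xcoord p)).
rewrite diff_potential// metricE// rp ap in H1.
rewrite diff_potential// metricE// rJ aJ in H2.
have ab : angular_form p w = radial_form p w.
  (* The bracket is the metric applied to [w] and the rotated vector; it vanishes by [H2], the
     potential being radial. *)
  have -> : angular_form p w = radial_form p w + sqn p ^+ 4 *
    (radial_form p w * 0 * (sqn p)^-1 ^+ 4
       - (radial_form p w * sqn p + 0 * angular_form p w) * (sqn p)^-1 ^+ 5
       + angular_form p w * sqn p * (sqn p)^-1 ^+ 5) by field.
  by rewrite -H2; ring.
have aE : radial_form p w = speed (sqn p) * sqn p.
  rewrite ab in H1.
  (* The bracket is the right-hand side of [H1] and equals [(sqn p - 1) / sqn p ^+ 4] times the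
     radial part. *)
  have -> : radial_form p w = sqn p ^+ 4 / (sqn p - 1) *
    (radial_form p w * sqn p * (sqn p)^-1 ^+ 4
       - (radial_form p w * 0 + sqn p * radial_form p w) * (sqn p)^-1 ^+ 5
       + radial_form p w * 0 * (sqn p)^-1 ^+ 5).
    by field; rewrite ?N0 ?N1 ?NS.
  by rewrite -H1 /speed; field; rewrite ?N0 ?N1 ?NS.
(* A vector is recovered from its radial and angular components. *)
have wx : xcoord w = (xcoord p * radial_form p w - ycoord p * angular_form p w) / sqn p.
  by rewrite /radial_form /angular_form /dx /dy /sqn in N0 *; field.
have wy : ycoord w = (ycoord p * radial_form p w + xcoord p * angular_form p w) / sqn p.
  by rewrite /radial_form /angular_form /dx /dy /sqn in N0 *; field.
by apply: plane_eqP; rewrite !coordE ?wx ?wy ab aE; field.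
Qed.

Lemma time_domain_near (R : realType) (T : \bar R) (t : R) :
  0 < t -> (t%:E < T)%E -> \forall s \near t, time_domain T s.
Proof.
move=> t0 tT.
have [b tb bT] : exists2 b, t < b & forall s, s < b -> (s%:E < T)%E.
  move: T tT => [T||//]; last by exists (t + 1); [rewrite ltrDl|move=> s _; exact: ltry].
  by rewrite lte_fin => tT; exists T.
near=> s; split; last by apply: bT; near: s; exact: lt_nbhsl.
by apply: ltW; near: s; exact: lt_nbhsr.
Unshelve. all: by end_near. Qed.

Lemma cvg_coord (R : realType) (F : set_system R) (FF : Filter F)
    (c : R -> plane R) (w : plane R) j :
  c s @[s --> F] --> w -> c s ord0 j @[s --> F] --> w ord0 j.
Proof.
move=> cw; apply: (cvg_comp c (fun p : plane R => p ord0 j) cw).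
exact: (differentiable_continuous (differentiable_coord w ord0 j)).
Qed.

Lemma has_derivative_within_coord (R : realType) D (c : R -> plane R) t w j :
  has_derivative_within D c t w ->
  (c s ord0 j - c t ord0 j) / (s - t) @[s --> within D t^'] --> w ord0 j.
Proof.
move=> /(cvg_coord _ _ _ _ _ j); apply: cvg_trans; apply: near_eq_cvg.
by apply: nearW => s; rewrite !mxE mulrC.
Qed.

(** At interior times the relative derivative is an ordinary one, so the usual rules of calculus
    apply to the coordinates of a solution. *)
Lemma has_derivative_within_is_derive (R : realType) D (c : R -> plane R) t w j :
  (\forall s \near t, D s) -> has_derivative_within D c t w ->
  is_derive t 1 (fun s => c s ord0 j) (w ord0 j).
Proof.
move=> Dt /(has_derivative_within_coord _ _ _ _ _ j) H.
apply/is_derive1_caratheodory.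
(* The Carathéodory slope: the difference quotient, completed at [t] by its limit. *)
exists (fun s => if s == t then w ord0 j else (c s ord0 j - c t ord0 j) / (s - t)).
split; last by rewrite eqxx.
- move=> z; case: eqP => [->|/eqP zt]; first by rewrite !subrr mulr0.
  by rewrite divfK// subr_eq0.
- apply/continuous_withinNx; rewrite eqxx.
  have H' : (c s ord0 j - c t ord0 j) / (s - t) @[s --> t^'] --> w ord0 j.
    apply: cvg_trans H; apply: cvg_fmap2.
    move=> A HA; have Dt' : t^' D by exact: nbhs_dnbhs.
    by apply: filterS2 Dt' (HA : t^' (fun s => D s -> A s)) => s Ds; apply.
  apply: cvg_trans H'; apply: near_eq_cvg; near=> s; rewrite ifF//.
  by apply/negbTE; near: s; exact: nbhs_dnbhs_neq.
Unshelve. all: by end_near. Qed.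

(** At the initial time only right continuity is kept from the one-sided derivative: the curve is
    its value at [0] plus [s] times a convergent quotient. *)
Lemma has_derivative_within_cvg (R : realType) (T : \bar R) (c : R -> plane R) w j :
  (0 < T)%E -> has_derivative_within (time_domain T) c 0 w ->
  c s ord0 j @[s --> 0^'+] --> c 0 ord0 j.
Proof.
move=> T0 /(has_derivative_within_coord _ _ _ _ _ j) H.
have Dr : \forall s \near 0^'+, time_domain T s.
  move: T T0 {H} => [T||//]; rewrite ?lte_fin => T0.
    near=> s; split; first by apply/ltW; near: s; exact: nbhs_right_gt.
    by rewrite lte_fin; near: s; exact: nbhs_right_lt.
  near=> s; split; last exact: ltry.
  by apply/ltW; near: s; exact: nbhs_right_gt.
have H' : (c s ord0 j - c 0 ord0 j) / (s - 0) @[s --> 0^'+] --> w ord0 j.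
  apply: cvg_trans H; apply: cvg_fmap2 => A HA.
  have HA' : \forall s \near (0 : R), s != 0 -> time_domain T s -> A s by [].
  near=> s.
  have s0 : 0 < s by near: s; exact: nbhs_right_gt.
  have : time_domain T s by near: s.
  have : s != 0 by rewrite gt_eqF.
  near: s; exact: (cvg_within _ HA').
have : c 0 ord0 j + (s * ((c s ord0 j - c 0 ord0 j) / (s - 0))) @[s --> 0^'+]
    --> c 0 ord0 j + 0 * w ord0 j.
  apply: cvgD; first exact: cvg_cst.
  by apply: cvgM => //; apply: cvg_at_right_filter; exact: cvg_id.
rewrite mul0r addr0; apply: cvg_trans; apply: near_eq_cvg; near=> s.
have s0 : 0 < s by near: s; exact: nbhs_right_gt.
by rewrite subr0; field; rewrite gt_eqF.
Unshelve. all: by end_near. Qed.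

Lemma is_derive_has_derivative_within (R : realType) D (X Y : R -> R) (t a b : R) :
  is_derive t 1 X a -> is_derive t 1 Y b ->
  has_derivative_within D (fun s => pt (X s) (Y s)) t (pt a b).
Proof.
move=> /is_derive1_caratheodory[g [gE gc <-]] /is_derive1_caratheodory[k [kE kc <-]].
have ptE (u v : R) : pt u v = u *: pt 1 0 + v *: pt 0 1.
  by apply: plane_eqP; rewrite !coordE; ring.
rewrite /has_derivative_within.
have H : g s *: pt 1 0 + k s *: pt 0 1 @[s --> within D t^'] --> (pt (g t) (k t) : plane R).
  rewrite [pt (g t) _]ptE; apply: cvgD; apply: cvgZr_tmp;
    apply: cvg_trans; try exact: gc; try exact: kc;
    apply: cvg_fmap2; apply: cvg_trans (cvg_within _) _; exact: cvg_within.
apply: cvg_trans H; apply: near_eq_cvg.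
have : within D t^' (fun s => s != t).
  by apply: filterS (nbhs_dnbhs_neq t) => s st _.
apply: filterS => s st.
have st0 : s - t != 0 by rewrite subr_eq0.
apply: plane_eqP; rewrite !coordE ?gE ?kE; field; exact: st0.
Unshelve. all: by end_near. Qed.

(** The tool for conserved quantities. The mean value theorem on [[e, t]] with [e > 0] gives
    [F e = F t]; letting [e] tend to [0] reaches the initial time, where no derivative is
    assumed. *)
Lemma derive0_right_cvg_cst (R : realType) (T : \bar R) (F : R -> R) :
  (forall t, 0 < t -> (t%:E < T)%E -> is_derive t 1 F 0) ->
  F s @[s --> 0^'+] --> F 0 ->
  forall t, time_domain T t -> F t = F 0.
Proof.
move=> dF F0 t [+ tT]; rewrite le_eqVlt => /predU1P[<-//|t0].
suff Ft : F s @[s --> 0^'+] --> F t by exact: (cvg_unique (@Rhausdorff R) Ft F0).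
have Fc : F t @[s --> (0 : R)^'+] --> F t by apply: cvg_cst.
apply: cvg_trans Fc; apply: near_eq_cvg; near=> e.
have e0 : 0 < e by near: e; exact: nbhs_right_gt.
have et : e < t by near: e; exact: nbhs_right_lt.
have xT x : x <= t -> (x%:E < T)%E by move=> xt; apply: le_lt_trans tT; rewrite lee_fin.
have [x _] : exists2 x, x \in `]e, t[ & F t - F e = 0 * (t - e).
  apply: (@MVT R F (fun=> 0) e t et) => [x|].
    rewrite in_itv/= => /andP[ex xt].
    by apply: dF; [exact: lt_trans ex|exact/xT/ltW].
  apply: derivable_within_continuous => x; rewrite in_itv/= => /andP[ex xt].
  by have [] := dF x (lt_le_trans e0 ex) (xT _ xt).
by rewrite mul0r => /eqP; rewrite subr_eq0 => /eqP.
Unshelve. all: by end_near. Qed.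

(** * Gradient curves are logarithmic spirals *)

(* The primitive of [(1 - s) * (1 + s) ^+ 2] vanishing at [0]. *)
Definition clock {R : realType} (s : R) : R := s + s ^+ 2 / 2 - s ^+ 3 / 3 - s ^+ 4 / 4.

(* [k] stands for [ln |p|], so that [expR (- (2 * k))] is [|p|^-2]. *)
Definition phase {R : realType} (k : R) : R := clock (expR (- (2 * k))).

(** In complex notation, [q] multiplied by the exponential of [(1 + i) k]. *)
Definition spiral {R : realType} (q : plane R) (k : R) : plane R :=
  pt (expR k * (cos k * xcoord q - sin k * ycoord q))
     (expR k * (sin k * xcoord q + cos k * ycoord q)).

(** * The clock and the phase *)

Lemma is_derive_clock (R : realType) (s : R) :
  is_derive s 1 (@clock R) ((1 - s) * (1 + s) ^+ 2).
Proof.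
have dX n : is_derive s 1 (id ^+ n : R -> R) (n%:R * s ^+ n.-1).
  by have := is_deriveX n (is_derive_id s 1); rewrite /GRing.scale/= mulr1.
have D := is_deriveB (is_deriveB (is_deriveD (is_derive_id s 1) (is_deriveZ 2^-1 (dX 2)))
  (is_deriveZ 3^-1 (dX 3))) (is_deriveZ 4^-1 (dX 4)).
rewrite (_ : @clock R =
  id + 2^-1 *: (id ^+ 2 : R -> R) - 3^-1 *: (id ^+ 3 : R -> R) - 4^-1 *: (id ^+ 4 : R -> R)).
  rewrite (_ : (1 - s) * _ = 1 + 2^-1 *: (2 * s ^+ 1) - 3^-1 *: (3 * s ^+ 2)
    - 4^-1 *: (4 * s ^+ 3)); first exact: D.
  by rewrite /GRing.scale/=; field.
by apply/funext => x; rewrite /clock !fctE /GRing.scale/=; field.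
Qed.

Lemma is_derive_expRN (R : realType) (a k : R) :
  is_derive k 1 (fun k => expR (- (a * k))) (- a * expR (- (a * k))).
Proof.
have D : is_derive k 1 (- (a *: id) : R -> R) (- a).
  by apply: is_derive_eq; rewrite /GRing.scale/= mulr1.
have := is_derive1_comp (is_derive_expR _) D.
by rewrite mulrC.
Qed.

Lemma is_derive_phase (R : realType) (k : R) :
  let s := expR (- (2 * k)) in
  is_derive k 1 (@phase R) (- 2 * s * ((1 - s) * (1 + s) ^+ 2)).
Proof.
by have := is_derive1_comp (is_derive_clock R _) (is_derive_expRN R 2 k); rewrite mulrC.
Qed.

Lemma clock_lt (R : realType) (a b : R) : 0 <= a -> a < b -> b <= 1 -> clock a < clock b.
Proof.
move=> a0 ab b1; rewrite -subr_gt0.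
(* With [b - a] factored out, the first bracket is positive because the four cubic terms are at most
   [1], one strictly; the second is nonnegative because squares in [[0, 1]] decrease and [a * b] is
   at most both [a] and [b]. *)
have -> : clock b - clock a =
  (b - a) * ((1 - (b ^+ 3 + b ^+ 2 * a + b * a ^+ 2 + a ^+ 3) / 4)
   + ((a + b) / 2 - (a ^+ 2 + a * b + b ^+ 2) / 3)) by rewrite /clock; field.
have aa : a ^+ 2 <= a by rewrite expr2; nra.
have bb : b ^+ 2 <= b by rewrite expr2; nra.
have ab1 : a * b <= a by nra.
have ab2 : a * b <= b by nra.
have a3 : a ^+ 3 <= a by rewrite exprS; nra.
have b3 : b ^+ 3 <= 1 by rewrite exprS; nra.
have a2b : b * a ^+ 2 <= 1 by nra.
have ab22 : b ^+ 2 * a <= 1 by nra.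
rewrite mulr_gt0 ?subr_gt0//; lra.
Qed.

Lemma clock0 (R : realType) : clock (0 : R) = 0.
Proof. by rewrite /clock; field. Qed.

Lemma phase_arg (R : realType) (k : R) : 0 < k -> 0 < expR (- (2 * k)) < 1.
Proof. by move=> k0; rewrite expR_gt0 expR_lt1 oppr_lt0 mulr_gt0. Qed.

Lemma phase_gt0 (R : realType) (k : R) : 0 < k -> 0 < phase k.
Proof.
by move=> /phase_arg/andP[s0 s1]; rewrite -(clock0 R) clock_lt// ltW.
Qed.

Lemma phase_lt (R : realType) (k l : R) : 0 < k -> k < l -> phase l < phase k.
Proof.
move=> k0 kl; have /andP[_ s1] := phase_arg _ _ k0.
apply: clock_lt; [exact: expR_ge0| |exact: ltW].
by rewrite ltr_expR ltrN2 ltr_pM2l.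
Qed.

Lemma phase_inj (R : realType) (k l : R) : 0 < k -> 0 < l -> phase k = phase l -> k = l.
Proof.
move=> k0 l0 kl; apply/eqP; rewrite eq_le !leNgt.
by apply/andP; split; apply/negP => lt_kl;
  [have := phase_lt _ _ _ l0 lt_kl|have := phase_lt _ _ _ k0 lt_kl]; rewrite kl ltxx.
Qed.

(** The intermediate value theorem gives [s] with [clock s = a]. As [a] is positive [s] is not [0],
    so [s] has the form [expR (- (2 * l))]. *)
Lemma phase_surj (R : realType) (k a : R) : 0 < k -> 0 < a -> a <= phase k ->
  exists2 l, 0 < l & phase l = a.
Proof.
move=> k0 a0 ak; have /andP[s0 s1] := phase_arg _ _ k0.
have [s] : exists2 s, s \in `[0, expR (- (2 * k))] & clock s = a.
  apply: IVT; first exact: ltW.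
    by apply: derivable_within_continuous => x _; have [] := is_derive_clock R x.
  by rewrite clock0 ge_min le_max (ltW a0) ak orbT.
rewrite in_itv/= le_eqVlt => /andP[/predU1P[<-|sp] sk] sa.
  by move: a0; rewrite -sa clock0 ltxx.
exists (- (ln s / 2)).
  rewrite oppr_gt0 pmulr_llt0 ?invr_gt0//.
  by apply: ln_lt0; rewrite sp (le_lt_trans sk s1).
rewrite /phase (_ : - (2 * _) = ln s); last by field.
by rewrite lnK.
Qed.

Lemma sqn_spiral (R : realType) (q : plane R) k : sqn (spiral q k) = expR k ^+ 2 * sqn q.
Proof.
rewrite /spiral {1}/sqn !coordE.
rewrite [RHS](_ : _ = expR k ^+ 2 * ((cos k ^+ 2 + sin k ^+ 2) * sqn q)).
  by rewrite /sqn; ring.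
by rewrite cos2Dsin2 mul1r.
Qed.

(** * Every solution runs along a spiral *)

Lemma derivable_cvg_comp (R : realType) (F : set_system R) {FF : Filter F}
  (G K : R -> R) (k dG : R) :
  is_derive k 1 G dG -> K s @[s --> F] --> k -> G (K s) @[s --> F] --> G k.
Proof.
move=> [/derivable1_diffP/differentiable_continuous cG _] cK.
exact: (cvg_comp K G cK cG).
Qed.

(** The left side is the derivative of [phase] times the rate of [k] along the flow: the phase
    decreases at the constant rate [4]. *)
Lemma phase_speed (R : realType) (k : R) : 0 < k ->
  let s := expR (- (2 * k)) in
  - 2 * s * ((1 - s) * (1 + s) ^+ 2) * speed (expR k ^+ 2) = - 4.
Proof.
move=> k0; rewrite /= expRN expRM_natl /speed.
have N1 : 1 < expR k ^+ 2 by rewrite exprn_egt1// expR_gt1.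
set N := expR k ^+ 2 in N1 *; have N0 : 0 < N by apply: lt_trans N1.
field; rewrite !gt_eqF// ?subr_gt0//; lra.
Qed.

(** Three quantities are conserved: the two coordinates of the solution after undoing the scaling
    and rotation by [k = ln |c|], and [phase k + 4 * t]. *)
Lemma solution_on_spiral (R : realType) (T : \bar R) (c : R -> plane R) :
  gradient_solution (exterior R) (inverted_metric R)
    (inverted_potential R) T c ->
  exists q (k : R -> R), [/\ sqn q = 1,
    forall t, time_domain T t -> 0 < k t,
    forall t, time_domain T t -> c t = spiral q (k t)
  & forall t, time_domain T t -> phase (k t) = phase (k 0) - 4 * t].
Proof.
move=> [T0 cU ode].
pose X t := xcoord (c t); pose Y t := ycoord (c t).
pose N t := sqn (c t); pose k t := ln (N t) / 2.
have D0 : time_domain T 0 by split.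
have N1 t : time_domain T t -> 1 < N t by move=> /cU/exteriorE.
have k0 t : time_domain T t -> 0 < k t.
  by move=> /N1 ?; rewrite divr_gt0// ln_gt0.
have expk t : time_domain T t -> expR (k t) ^+ 2 = N t.
  move=> /N1 Nt; rewrite -expRM_natl /k (_ : _ * _ = ln (N t)); last by field.
  by rewrite lnK// posrE (lt_trans _ Nt).
have ode' t : time_domain T t -> has_derivative_within (time_domain T) c t
    (speed (N t) *: pt (X t - Y t) (X t + Y t)).
  by move=> Dt; have [w] := ode t Dt; move=> /(gradientE _ _ _ (cU t Dt)) ->.
have dX t : 0 < t -> (t%:E < T)%E -> is_derive t 1 X (speed (N t) * (X t - Y t)).
  move=> t0 tT; have Dt : time_domain T t by split=> //; exact: ltW.
  have := has_derivative_within_is_derive _ _ _ _ _ ord0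
    (time_domain_near _ _ _ t0 tT) (ode' t Dt).
  by rewrite !mxE.
have dY t : 0 < t -> (t%:E < T)%E -> is_derive t 1 Y (speed (N t) * (X t + Y t)).
  move=> t0 tT; have Dt : time_domain T t by split=> //; exact: ltW.
  have := has_derivative_within_is_derive _ _ _ _ _ ord_max
    (time_domain_near _ _ _ t0 tT) (ode' t Dt).
  by rewrite !mxE.
have cX : X s @[s --> 0^'+] --> X 0.
  exact: (has_derivative_within_cvg _ _ _ _ ord0 T0 (ode' 0 D0)).
have cY : Y s @[s --> 0^'+] --> Y 0.
  exact: (has_derivative_within_cvg _ _ _ _ ord_max T0 (ode' 0 D0)).
have cN : N s @[s --> 0^'+] --> N 0.
  by apply: cvgD; rewrite ?expr2; apply: cvgM.
have dk t : 0 < t -> (t%:E < T)%E -> is_derive t 1 k (speed (N t)).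
  move=> t0 tT; have Dt : time_domain T t by split=> //; exact: ltW.
  have Nt := N1 t Dt; have Np : 0 < N t by apply: lt_trans Nt.
  have dN : is_derive t 1 N (2 * speed (N t) * N t).
    rewrite (_ : N = X ^+ 2 + Y ^+ 2); last by apply/funext => s; rewrite !fctE.
    apply: (is_derive_eq (is_deriveD (is_deriveX 2 (dX t t0 tT))
      (is_deriveX 2 (dY t t0 tT)))).
    rewrite /GRing.scale/= expr1.
    rewrite [X in _ = _ * X](_ : N t = X t ^+ 2 + Y t ^+ 2)//; ring.
  have dl := is_derive1_comp (is_derive1_ln Np) dN.
  rewrite (_ : k = 2^-1 *: (@ln R \o N)); last first.
    by apply/funext => s; rewrite /k !fctE mulrC.
  apply: is_derive_eq; rewrite /GRing.scale/=; field.
  by rewrite gt_eqF.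
have ck : k s @[s --> 0^'+] --> k 0.
  apply: cvgM; last exact: cvg_cst.
  by apply: derivable_cvg_comp cN; apply: is_derive1_ln; apply: lt_trans (N1 _ D0).
(* Coefficients of the inverse spiral map, scaling by [expR (- x)] and rotation by [- x]. *)
pose E1 (x : R) := expR (- x) * cos x; pose E2 (x : R) := expR (- x) * sin x.
have dE (x : R) : is_derive x 1 (expR \o -%R) (- expR (- x)).
  by have := is_derive1_comp (is_derive_expR (- x)) (is_deriveNid x 1); rewrite mulrN1.
have dE1 (x : R) : is_derive x 1 E1 (- E1 x - E2 x).
  rewrite [X in is_derive _ _ X _](_ : _ = (expR \o -%R) * cos); last by apply/funext.
  by apply: is_derive_eq; rewrite /E1 /E2 /GRing.scale/=; ring.
have dE2 (x : R) : is_derive x 1 E2 (E1 x - E2 x).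
  rewrite [X in is_derive _ _ X _](_ : _ = (expR \o -%R) * sin); last by apply/funext.
  by apply: is_derive_eq; rewrite /E1 /E2 /GRing.scale/=; ring.
have dE1k t (t0 : 0 < t) (tT : (t%:E < T)%E) := is_derive1_comp (dE1 (k t)) (dk t t0 tT).
have dE2k t (t0 : 0 < t) (tT : (t%:E < T)%E) := is_derive1_comp (dE2 (k t)) (dk t t0 tT).
have cE1 : E1 (k s) @[s --> 0^'+] --> E1 (k 0).
  exact: (derivable_cvg_comp _ _ _ _ _ _ (dE1 (k 0)) ck).
have cE2 : E2 (k s) @[s --> 0^'+] --> E2 (k 0).
  exact: (derivable_cvg_comp _ _ _ _ _ _ (dE2 (k 0)) ck).
(* [(Q1, Q2)] is the base point [q] of the spiral through [c t]; it is shown not to depend on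
   [t]. *)
pose Q1 t := E1 (k t) * X t + E2 (k t) * Y t.
pose Q2 t := E1 (k t) * Y t - E2 (k t) * X t.
have Q1c t : time_domain T t -> Q1 t = Q1 0.
  apply: (derive0_right_cvg_cst _ _ Q1) => [{}t t0 tT|]; last first.
    exact: (cvgD (cvgM cE1 cX) (cvgM cE2 cY)).
  rewrite (_ : Q1 = (E1 \o k) * X + (E2 \o k) * Y); last by apply/funext.
  have D := is_deriveD (is_deriveM (dE1k t t0 tT) (dX t t0 tT))
    (is_deriveM (dE2k t t0 tT) (dY t t0 tT)).
  by apply: (is_derive_eq D); rewrite /GRing.scale/=; ring.
have Q2c t : time_domain T t -> Q2 t = Q2 0.
  apply: (derive0_right_cvg_cst _ _ Q2) => [{}t t0 tT|]; last first.
    exact: (cvgB (cvgM cE1 cY) (cvgM cE2 cX)).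
  rewrite (_ : Q2 = (E1 \o k) * Y - (E2 \o k) * X); last by apply/funext.
  have D := is_deriveB (is_deriveM (dE1k t t0 tT) (dY t t0 tT))
    (is_deriveM (dE2k t t0 tT) (dX t t0 tT)).
  by apply: (is_derive_eq D); rewrite /GRing.scale/=; ring.
have ek x : expR x != 0 :> R by rewrite gt_eqF// expR_gt0.
exists (pt (Q1 0) (Q2 0)), k; split => //.
- rewrite /sqn !coordE /Q1 /Q2 /E1 /E2 expRN.
  have -> : ((expR (k 0))^-1 * cos (k 0) * X 0 + (expR (k 0))^-1 * sin (k 0) * Y 0) ^+ 2 +
    ((expR (k 0))^-1 * cos (k 0) * Y 0 - (expR (k 0))^-1 * sin (k 0) * X 0) ^+ 2
    = (expR (k 0) ^+ 2)^-1 * ((cos (k 0) ^+ 2 + sin (k 0) ^+ 2) * (X 0 ^+ 2 + Y 0 ^+ 2)).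
    by field.
  rewrite cos2Dsin2 mul1r expk// mulVf// gt_eqF// (lt_trans _ (N1 _ D0))//.
- move=> t Dt; rewrite /spiral !coordE -(Q1c t Dt) -(Q2c t Dt) /Q1 /Q2 /E1 /E2 expRN.
  have e : cos (k t) ^+ 2 + sin (k t) ^+ 2 = 1 by exact: cos2Dsin2.
  apply: plane_eqP; rewrite !coordE.
    (* Inserting [cos ^+ 2 + sin ^+ 2] for [1] turns the goal into a purely algebraic identity. *)
    rewrite -/(X t) -[LHS]mul1r -e; field; exact: ek.
  rewrite -/(Y t) -[LHS]mul1r -e; field; exact: ek.
- move=> t Dt; pose F t := phase (k t) + 4 * t.
  suff : F t = F 0 by rewrite /F mulr0 addr0 => <-; rewrite addrK.
  apply: (derive0_right_cvg_cst _ T F) => [{Dt}{}t t0 tT||]; last exact: Dt.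
    have Dt : time_domain T t by split=> //; exact: ltW.
    have Dp := is_derive1_comp (is_derive_phase R (k t)) (dk t t0 tT).
    have Di := is_deriveZ 4 (is_derive_id t 1).
    rewrite (_ : F = phase \o k + 4 *: id); last by apply/funext.
    have D := is_deriveD Dp Di; apply: (is_derive_eq D).
    have := phase_speed _ _ (k0 t Dt); rewrite expk// /= => ->.
    by rewrite /GRing.scale/=; ring.
  apply: cvgD; first exact: (derivable_cvg_comp _ _ _ _ _ _ (is_derive_phase R (k 0)) ck).
  apply: cvg_at_right_filter; apply: cvgM; [exact: cvg_cst|exact: cvg_id].
Qed.

(** * Spirals as solutions, and maximality *)

Lemma is_derive_spiral (R : realType) (q : plane R) (k : R) :
  is_derive k 1 (fun k => xcoord (spiral q k)) (xcoord (spiral q k) - ycoord (spiral q k)) /\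
  is_derive k 1 (fun k => ycoord (spiral q k)) (xcoord (spiral q k) + ycoord (spiral q k)).
Proof.
have De := is_derive_expR k; have Dc := is_derive_cos k; have Ds := is_derive_sin k.
split.
- have D := is_deriveM De (is_deriveB (is_deriveZ (xcoord q) Dc) (is_deriveZ (ycoord q) Ds)).
  rewrite [X in is_derive _ _ X _](_ : _ =
    expR * (xcoord q *: (cos : R -> R) - ycoord q *: (sin : R -> R))); last first.
    by apply/funext => l; rewrite !coordE !fctE /GRing.scale/=; ring.
  apply: (is_derive_eq D); rewrite !coordE.
  rewrite [LHS](_ : _ = expR k * (xcoord q * - sin k - ycoord q * cos k) +
    (xcoord q * cos k - ycoord q * sin k) * expR k)//; ring.
- have D := is_deriveM De (is_deriveD (is_deriveZ (xcoord q) Ds) (is_deriveZ (ycoord q) Dc)).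
  rewrite [X in is_derive _ _ X _](_ : _ =
    expR * (xcoord q *: (sin : R -> R) + ycoord q *: (cos : R -> R))); last first.
    by apply/funext => l; rewrite !coordE !fctE /GRing.scale/=; ring.
  apply: (is_derive_eq D); rewrite !coordE.
  rewrite [LHS](_ : _ = expR k * (xcoord q * cos k + ycoord q * - sin k) +
    (xcoord q * sin k + ycoord q * cos k) * expR k)//; ring.
Qed.

(** [kappa] inverts [tau], the time at which the spiral started at [k0] reaches [k]; its derivative
    comes from the inverse function rule and [phase_speed]. *)
Lemma phase_inverse (R : realType) (k0 : R) : 0 < k0 ->
  exists kappa : R -> R, forall t, 0 <= t < phase k0 / 4 ->
    [/\ 0 < kappa t, phase (kappa t) = phase k0 - 4 * t
      & is_derive t 1 kappa (speed (expR (kappa t) ^+ 2))].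
Proof.
(* The default [0] is never taken on the interval considered, by [phase_surj]. *)
move=> k00; pose kappa (t : R) : R := xget 0 [set k | 0 < k /\ phase k = phase k0 - 4 * t].
exists kappa => t /andP[t0 tT].
pose tau (k : R) : R := (phase k0 - phase k) / 4.
have tauK (k : R) : 0 < k -> kappa (tau k) = k.
  move=> k_gt0; have ex : exists l, [set l | 0 < l /\ phase l = phase k0 - 4 * tau k] l.
    by exists k; split=> //; rewrite /tau; field.
  have [kp] := xgetPex 0 ex; rewrite -/(kappa (tau k)) in kp *.
  rewrite (_ : _ - _ = phase k); last by rewrite /tau; field.
  exact: phase_inj.
have [l l0 lE] : exists2 l, 0 < l & phase l = phase k0 - 4 * t.
  by apply: (phase_surj _ k0) => //; lra.
have tl : tau l = t by rewrite /tau lE; field.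
rewrite -tl tauK//; split=> //; first by rewrite tl.
have dtau (k : R) : is_derive k 1 tau (- 4^-1 *: (- 2 * expR (- (2 * k)) *
    ((1 - expR (- (2 * k))) * (1 + expR (- (2 * k))) ^+ 2))).
  have D := is_deriveB (is_derive_cst (phase k0 / 4 : R) k 1)
    (is_deriveZ 4^-1 (is_derive_phase R k)).
  rewrite (_ : tau = cst (phase k0 / 4) - 4^-1 *: (@phase R)); last first.
    by apply/funext => s; rewrite /tau !fctE /GRing.scale/=; field.
  by apply: (is_derive_eq D); rewrite sub0r scaleNr.
pose d := - 2 * expR (- (2 * l)) * ((1 - expR (- (2 * l))) * (1 + expR (- (2 * l))) ^+ 2).
have dE : d * speed (expR l ^+ 2) = - 4 by exact: phase_speed l0.
have d0 : d != 0 by apply/eqP => d0; move: dE; rewrite d0 mul0r; lra.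
have -> : speed (expR l ^+ 2) = (- 4^-1 *: d)^-1.
  have -> : speed (expR l ^+ 2) = - 4 / d by rewrite -dE mulrC mulKf.
  by rewrite /GRing.scale/=; field.
(* The cancellation holds for every [k > 0], also below [k0], so the derivative is two-sided even at
   [t = 0]. *)
apply: is_derive_inverse (dtau l) _.
- near=> k; apply: tauK; near: k; exact: lt_nbhsr.
- near=> k; apply: differentiable_continuous; apply/derivable1_diffP.
  by have [] := dtau k.
- by rewrite scaler_eq0 oppr_eq0 invr_eq0 pnatr_eq0.
Unshelve. all: by end_near. Qed.

Lemma spiral_exterior (R : realType) (q : plane R) (k : R) :
  sqn q = 1 -> 0 < k -> (exterior R) (spiral q k).
Proof.
move=> q1 k0; apply/exteriorE.
by rewrite sqn_spiral q1 mulr1 exprn_egt1// expR_gt1.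
Qed.

Lemma spiral_solution (R : realType) (q : plane R) (k0 : R) : sqn q = 1 -> 0 < k0 ->
  exists kappa : R -> R,
    (forall t, 0 <= t < phase k0 / 4 -> 0 < kappa t /\ phase (kappa t) = phase k0 - 4 * t) /\
    gradient_solution (exterior R) (inverted_metric R)
      (inverted_potential R) (phase k0 / 4)%:E
      (fun t => spiral q (kappa t)).
Proof.
move=> q1 k00; have [kappa H] := phase_inverse _ _ k00; exists kappa.
have domE t : time_domain (phase k0 / 4)%:E t -> 0 <= t < phase k0 / 4.
  by move=> [t0]; rewrite lte_fin => ->; rewrite t0.
split; first by move=> t /H[].
split; first by rewrite lte_fin divr_gt0// phase_gt0.
  by move=> t /domE/H[kt _ _]; exact: spiral_exterior.
move=> t /domE/H[kt _ dk].
have Ut := spiral_exterior _ _ _ q1 kt.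
exists (speed (sqn (spiral q (kappa t))) *: pt
  (xcoord (spiral q (kappa t)) - ycoord (spiral q (kappa t)))
  (xcoord (spiral q (kappa t)) + ycoord (spiral q (kappa t)))); first exact/gradientE.
(* With respect to [k] the spiral moves along the gradient direction; the chain rule with [kappa]
   supplies the factor [speed]. *)
have [dx dy] := is_derive_spiral _ q (kappa t).
have dX := is_derive1_comp dx dk; have dY := is_derive1_comp dy dk.
have := is_derive_has_derivative_within _ (time_domain (phase k0 / 4)%:E) _ _ _ _ _ dX dY.
rewrite (_ : (fun s => pt _ _) = (fun t => spiral q (kappa t))); last first.
  by apply/funext => s; rewrite /= pt_coord.
congr has_derivative_within.
rewrite sqn_spiral q1 mulr1.
by apply: plane_eqP; rewrite !coordE mulrC.
Qed.

(** The phase stays positive, which bounds [T]; the spiral solution lives up to that bound and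
    agrees with [c] by injectivity of [phase], so maximality forces equality. *)
Lemma gradient_curve_on_spiral (R : realType) (T : \bar R) (c : R -> plane R) :
  gradient_curve (exterior R) (inverted_metric R)
    (inverted_potential R) T c ->
  exists q (k : R -> R), [/\ sqn q = 1, 0 < k 0, T = (phase (k 0) / 4)%:E
    & forall t, time_domain T t ->
      [/\ 0 < k t, c t = spiral q (k t) & phase (k t) = phase (k 0) - 4 * t]].
Proof.
move=> [sol maxT]; have T0 := solution_time sol.
have [q [k [q1 kp cE phE]]] := solution_on_spiral _ _ _ sol.
have k00 : 0 < k 0 by apply: kp; split.
exists q, k; split=> //; last by move=> t Dt; split; [exact: kp|exact: cE|exact: phE].
have [kappa [kaE solk]] := spiral_solution _ _ _ q1 k00.
have TT : (T <= (phase (k 0) / 4)%:E)%E.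
  rewrite leNgt; apply/negP => TT.
  have DT : time_domain T (phase (k 0) / 4).
    by split=> //; rewrite divr_ge0// ltW// phase_gt0.
  (* At time [phase (k 0) / 4] the phase would be [0]. *)
  have := phase_gt0 _ _ (kp _ DT); rewrite phE//; lra.
apply/esym/(maxT _ _ solk TT) => t Dt.
have [t0 tT] := Dt.
have /kaE[kat phkat] : 0 <= t < phase (k 0) / 4.
  by rewrite t0 -lte_fin (lt_le_trans tT).
rewrite cE//; congr (spiral q _).
by apply: phase_inj => //; [exact: kp|rewrite phkat (phE t Dt)].
Qed.

(** * Behaviour at infinity *)

Lemma angle_exists (R : realType) (a b : R) : a ^+ 2 + b ^+ 2 = 1 ->
  exists x, cos x = a /\ sin x = b.
Proof.
move=> ab1.
have a1 : -1 <= a <= 1.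
  rewrite -ler_norml -(ler_pXn2r (n := 2))// ?nnegrE//.
  by rewrite real_normK ?num_real// expr1n -ab1 lerDl sqr_ge0.
have bE : Num.sqrt (1 - a ^+ 2) = `|b| by rewrite -ab1 addrAC subrr add0r sqrtr_sqr.
have ca : cos (acos a) = a by apply: acosK; rewrite in_itv.
have [b0|b0] := leP 0 b.
  by exists (acos a); rewrite ca sin_acos// bE ger0_norm.
by exists (- acos a); rewrite cosN sinN ca sin_acos// bE ltr0_norm// opprK.
Qed.

(** The logarithmic radius takes every value from [k 0] on: the time is read off from the linear law
    for the phase, and lies in the domain because [0 < phase l <= phase (k 0)]. *)
Lemma phase_time (R : realType) (T : \bar R) (k : R -> R) :
  0 < k 0 -> T = (phase (k 0) / 4)%:E ->
  (forall t, time_domain T t -> 0 < k t /\ phase (k t) = phase (k 0) - 4 * t) ->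
  forall l, k 0 <= l -> exists2 t, time_domain T t & k t = l.
Proof.
move=> k0 -> kE l; rewrite le_eqVlt => /predU1P[<-|k0l].
  by exists 0 => //; split=> //; rewrite lte_fin divr_gt0// phase_gt0.
have l0 : 0 < l by apply: lt_trans k0l.
have lp := phase_gt0 _ _ l0; have lk := phase_lt _ _ _ k0 k0l.
have Dt : time_domain (phase (k 0) / 4)%:E ((phase (k 0) - phase l) / 4).
  by split; rewrite ?lte_fin; lra.
exists ((phase (k 0) - phase l) / 4) => //.
by have [kt phk] := kE _ Dt; apply: phase_inj => //; rewrite phk; field.
Qed.

Lemma compact_sqn_bounded (R : realType) (K : set (plane R)) :
  compact K -> exists2 M, 0 < M & forall p, K p -> sqn p <= M.
Proof.
move=> cK; have : compact (@sqn R @` K).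
  apply: continuous_compact cK; apply: continuous_subspaceT => p.
  exact: (differentiable_continuous (differentiable_sqn R p)).
move=> /compact_bounded[M [_ HM]].
exists (`|M| + 1); first by rewrite ltr_wpDl.
move=> p Kp; apply: le_trans (ler_norm _) _.
by apply: (HM (`|M| + 1)); [rewrite (le_lt_trans (ler_norm _))// ltrDl|exists p].
Qed.

Lemma spiral_leaves_compacts (R : realType) (T : \bar R) (c : R -> plane R)
    q (k : R -> R) :
  sqn q = 1 -> 0 < k 0 -> T = (phase (k 0) / 4)%:E ->
  (forall t, time_domain T t ->
    [/\ 0 < k t, c t = spiral q (k t) & phase (k t) = phase (k 0) - 4 * t]) ->
  leaves_compacts T c.
Proof.
move=> q1 k0 TE cE K /compact_sqn_bounded[M M0 KM].
(* The maximum is taken because only values at least [k 0] are known to be reached. *)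
have [t1 Dt1 kt1] : exists2 t, time_domain T t & k t = Num.max (k 0) M.
  by apply: phase_time => //; [move=> t /cE[]|rewrite le_max lexx].
exists t1 => // t t1t tT Kt.
have Dt : time_domain T t by split=> //; apply: le_trans (ltW t1t); case: Dt1.
have [kt0 ct kt] := cE t Dt; have [kt10 _ kt1E] := cE t1 Dt1.
(* The phase decreases in time and in [k], so [k] increases in time. *)
have kk : M < k t.
  rewrite ltNge; apply/negP => ktM.
  have : k t <= k t1 by rewrite kt1 le_max ktM orbT.
  rewrite le_eqVlt => /predU1P[e|/(phase_lt _ _ _ kt0)]; last by lra.
  by move: kt; rewrite e kt1E; lra.
have := KM _ Kt; rewrite ct sqn_spiral q1 mulr1 leNgt => /negP; apply.
apply: lt_trans kk _.
(* [k t < expR (k t) <= expR (k t) ^+ 2], and the last term is the squared norm of [c t]. *)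
have ek := expR_ge1Dx (k t).
by apply: (@lt_le_trans _ _ (expR (k t))); [lra|rewrite ler_eXnr//; lra].
Qed.

Lemma spiral_clusters (R : realType) (T : \bar R) (c : R -> plane R)
    q (k : R -> R) :
  sqn q = 1 -> 0 < k 0 -> T = (phase (k 0) / 4)%:E ->
  (forall t, time_domain T t ->
    [/\ 0 < k t, c t = spiral q (k t) & phase (k t) = phase (k 0) - 4 * t]) ->
  clusters_on_circle_at_infinity T c.
Proof.
move=> q1 k0 TE cE u; rewrite /circle/= => u1.
have u1' : sqn u = 1 by rewrite -enorm_sqr u1 expr1n.
(* [x] is the angle from [q] to [u]: its cosine and sine are their scalar product and
   determinant. *)
have [x [cx sx]] : exists x, cos x = xcoord u * xcoord q + ycoord u * ycoord q /\
    sin x = ycoord u * xcoord q - xcoord u * ycoord q.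
  apply: angle_exists; transitivity (sqn u * sqn q); last by rewrite u1' q1 mulr1.
  by rewrite /sqn; ring.
have [m xm] : exists m : nat, k 0 <= x + m%:R * (pi *+ 2).
  have [m mP] : exists m : nat, k 0 - x <= m%:R.
    by exists (Num.truncn `|k 0 - x|).+1; rewrite (le_trans (ler_norm _))// ltW// truncnS_gt.
  exists m; have := pi_ge2 R; rewrite mulr2n => p2.
  have m0 : 0 <= m%:R :> R by []. nra.
(* One passage through the direction [u] per turn; the [m] initial turns bring [l n] above [k 0],
   where [phase_time] applies. *)
pose l n : R := x + m%:R * (pi *+ 2) + n%:R * (pi *+ 2).
have pi0 : 0 <= pi *+ 2 :> R by rewrite mulrn_wge0// pi_ge0.
have lk n : k 0 <= l n by rewrite (le_trans xm)// lerDl mulr_ge0.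
have [t tE] : {t : nat -> R & forall n, time_domain T (t n) /\ k (t n) = l n}.
  apply: (@boolp.choice nat R (fun n t => time_domain T t /\ k t = l n)) => n.
  have [t Dt kt] : exists2 t, time_domain T t & k t = l n.
    by apply: phase_time => // t /cE[].
  by exists t.
have csl n : cos (l n) = cos x /\ sin (l n) = sin x.
  rewrite /l !mulr_natl; split.
    by rewrite (periodicn (@cosD2pi R)) (periodicn (@cosD2pi R)).
  by rewrite (periodicn (@sinD2pi R)) (periodicn (@sinD2pi R)).
have cl n : c (t n) = expR (l n) *: u.
  have [Dt kt] := tE n; have [_ -> _] := cE _ Dt; rewrite kt /spiral.
  have [-> ->] := csl n; rewrite cx sx.
  apply: plane_eqP; rewrite !coordE; congr (_ * _); rewrite -[RHS]mulr1 -q1 /sqn; ring.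
have nl n : enorm (expR (l n) *: u) = expR (l n).
  apply: (@pexpIrn R 2); rewrite ?nnegrE ?enorm_ge0 ?expR_ge0//.
  by rewrite enorm_sqr -[RHS]mulr1 -u1' /sqn !coordE; ring.
exists (c \o t); split.
- by move=> n; exists (t n) => //; case: (tE n).
- apply: (ger_cvgy _ (@cvgr_idn R)); apply: nearW => n /=.
  rewrite cl nl; apply: le_trans (expR_ge1Dx _).
  have n0 : 0 <= n%:R :> R by [].
  have : n%:R <= n%:R * (pi *+ 2) :> R.
    by rewrite ler_peMr// mulr2n; have := pi_ge2 R; lra.
  by have := xm; rewrite /l; lra.
(* The chosen points lie exactly on the ray of [u], so the normalised sequence is constant. *)
- have -> : (fun n => (enorm ((c \o t) n))^-1 *: (c \o t) n) = fun=> u.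
    apply/funext => n /=; rewrite cl nl scalerA mulVf ?scale1r//.
    by rewrite gt_eqF// expR_gt0.
  exact: cvg_cst.
Qed.


Theorem proposition5p1 (R : realType) :
  let B1' : set (plane R) := @open_disk R `\ 0 in
  let U : set (plane R) := ~` @closed_disk R in
  let metric : two_tensor R := pullback_tensor (@inversion R) (@h R) in
  let potential : plane R -> R :=
    pullback_fun (@inversion R) (fun p => - f p) in
  [/\ positive_definite_on B1' (@h R),
      U = [set p | p != 0 /\ B1' (inversion p)],
      smooth_semialgebraic_metric_on U metric
    & forall (T : \bar R) (gamma : R -> plane R),
        gradient_curve U metric potential T gamma ->
        leaves_compacts T gamma /\
        clusters_on_circle_at_infinity T gamma].
Proof.
split.
- exact: h_positive_definite.
- exact: exterior_inversion.
- exact: smooth_semialgebraic_inverted_metric.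
- move=> T gamma /gradient_curve_on_spiral[q [k [q1 k0 TE kE]]].
  by split; [exact: spiral_leaves_compacts kE|exact: spiral_clusters kE].
Qed.
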